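(* Let $p \in [1, \infty)$, let $G$ be a second countable locally compact abelian group, and let $(G, A, \alpha)$ be an isometric $G$-$L^p$ operator algebra such that $A$ is nondegenerately $\sigma$-finitely representable. Then there exists a unique continuous isometric action $\tau \mapsto \widehat{\alpha}_\tau$ of the Pontryagin dual $\widehat{G}$ on $F^p(G, A, \alpha)$ such that the canonical map $\iota \colon C_{\mathrm c}(G, A, \alpha) \to F^p(G, A, \alpha)$ is equivariant, where $\widehat G$ acts on $C_{\mathrm c}(G, A, \alpha)$ by $\widehat{\alpha}_\tau(a)(g) = \overline{\tau(g)}\, a(g)$ for $\tau\in\widehat G$, $a\in C_{\mathrm c}(G,A,\alpha)$, and $g\in G$.
   Context: $L(E)$ is the algebra of bounded operators on a Banach space $E$. An $L^p$ operator algebra is a Banach algebra (not necessarily unital) isometrically isomorphic to a norm closed subalgebra of $L(L^p(X,\mu))$ for some measure space $(X,\mathcal B,\mu)$. A representation of $A$ on $L^p(X,\mu)$ is a continuous homomorphism $\pi\colon A\to L(L^p(X,\mu))$; it is contractive if $\|\pi(a)\|\le\|a\|$ for all $a$, isometric if $\|\pi(a)\|=\|a\|$ for all $a$, $\sigma$-finite if $\mu$ is $\sigma$-finite, and nondegenerate if the span of $\{\pi(a)\xi\}$ is dense. $A$ is nondegenerately $\sigma$-finitely representable if it has a nondegenerate $\sigma$-finite isometric representation. An action of a topological group $H$ on a Banach algebra $B$ is a homomorphism $h\mapsto\beta_h$ from $H$ to the continuous algebra automorphisms of $B$ such that $h\mapsto\beta_h(b)$ is continuous for every $b\in B$ (this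 is what ''continuous'' refers to); it is isometric if every $\beta_h$ is isometric. An isometric $G$-$L^p$ operator algebra $(G,A,\alpha)$ is an $L^p$ operator algebra $A$ with an isometric action $\alpha$ of $G$. A covariant representation of $(G,A,\alpha)$ on $L^p(X,\mu)$ is a pair $(v,\pi)$ of a strongly continuous representation $g\mapsto v_g$ of $G$ by invertible bounded operators and a representation $\pi$ of $A$, both on $L^p(X,\mu)$, with $\pi(\alpha_g(a))=v_g\pi(a)v_g^{-1}$. It is contractive if $\|v_g\|\le 1$ for all $g$ and $\pi$ is contractive; it is nondegenerate or $\sigma$-finite if $\pi$ is. $\nu$ is a Haar measure on $G$. $C_{\mathrm c}(G,A,\alpha)$ is the space of compactly supported continuous functions $G\to A$ with product $(ab)(g)=\int_G a(h)\alpha_h(b(h^{-1}g))\,d\nu(h)$, and $(v\ltimes\pi)(a)\xi=\int_G\pi(a(g))v_g\xi\,d\nu(g)$. The full $L^p$ operator crossed product $F^p(G,A,\alpha)$ is the Hausdorff completion of $C_{\mathrm c}(G,A,\alpha)$ in the seminorm $a\mapsto\sup\|(v\ltimes\pi)(a)\|$, over all nondegenerate $\sigma$-finite contractive covariant representations $(v,\pi)$ on $L^p$ spaces; $\iota$ is the canonical map to the completion. *)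

(* Defs.v *)
From HB Require Import structures.
From mathcomp Require Import all_boot all_order all_algebra generic_quotient complex.
From mathcomp Require Import all_classical all_reals all_analysis measurable_realfun.

Set Implicit Arguments.
Unset Strict Implicit.
Unset Printing Implicit Defensive.

Import Order.TTheory GRing.Theory Num.Theory.
Import numFieldNormedType.Exports.

Local Open Scope classical_set_scope.
Local Open Scope complex_scope.
Local Open Scope ring_scope.

Lemma normc_ge0 (R : rcfType) (c : R[i]) : 0 <= Normc.normc c.
Proof. by case: c => a b; exact: sqrtr_ge0. Qed.

Lemma normcD (R : rcfType) (a b : R[i]) :
  Normc.normc (a + b) <= Normc.normc a + Normc.normc b.
Proof. by rewrite -lecR rmorphD; exact: (ler_normD a b). Qed.

Section real_norm.
Context {R : realType} {E : normedModType R[i]}.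
Implicit Types x y : E.

(* The norm of a complex normed space is valued in [R[i]]; [rnorm] is the same
   number seen in [R]. *)
Definition rnorm x : R := complex.Re `|x|.

Lemma rnormE x : `|x| = (rnorm x)%:C.
Proof. by rewrite /rnorm; case: (`|x|) (ger0_Im (normr_ge0 x)) => a b /= ->. Qed.

Lemma rnorm_ge0 x : 0 <= rnorm x.
Proof. by rewrite -lecR -rnormE normr_ge0. Qed.

Lemma rnormD x y : rnorm (x + y) <= rnorm x + rnorm y.
Proof. by rewrite -lecR rmorphD/= -!rnormE ler_normD. Qed.

Lemma rnormZ (c : R[i]) x : rnorm (c *: x) = Normc.normc c * rnorm x.
Proof. by apply: complexI; rewrite rmorphM/= -!rnormE normrZ. Qed.

Lemma rnorm0 : rnorm (0 : E) = 0.
Proof. by rewrite /rnorm normr0. Qed.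

Lemma rnorm_eq0 x : rnorm x = 0 -> x = 0.
Proof. by move=> x0; apply/normr0_eq0; rewrite rnormE x0. Qed.

End real_norm.

(* Normed algebras, not necessarily unital (the ring structures of the algebra
   library all have a unit). *)
HB.mixin Record NormedModule_isNormedAlgebra (K : numFieldType) A
    of NormedModule K A := {
  amul : A -> A -> A ;
  amulA : associative amul ;
  amulDl : left_distributive amul +%R ;
  amulDr : right_distributive amul +%R ;
  amulZl : forall (k : K) (a b : A), amul (k *: a) b = k *: amul a b ;
  amulZr : forall (k : K) (a b : A), amul a (k *: b) = k *: amul a b ;
  ler_normAM : forall a b : A, `|amul a b| <= `|a| * `|b|
}.

#[short(type="normedAlgType")]
HB.structure Definition NormedAlgebra (K : numFieldType) :=
  {A of NormedModule K A & NormedModule_isNormedAlgebra K A}.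

#[short(type="banachAlgType")]
HB.structure Definition BanachAlgebra (K : numFieldType) :=
  {A of NormedAlgebra K A & Complete A}.

Notation "a ** b" := (amul a b) (at level 40, left associativity) : ring_scope.

Section bounded_operators.
Context {R : realType} (E : normedModType R[i]).

(* Defined for all maps, so that no boundedness proof is needed to write it. *)
Definition eopnorm (T : E -> E) : \bar R :=
  ereal_sup [set (rnorm (T x))%:E | x in [set x | rnorm x <= 1]].

Definition bounded_op : {pred E -> E} := mem
  [set f : E -> E | linear f /\ exists M : R, forall x, rnorm (f x) <= M * rnorm x].

Lemma bounded_opP (f : E -> E) : f \in bounded_op <->
  linear f /\ exists M : R, forall x, rnorm (f x) <= M * rnorm x.
Proof. by rewrite in_setE. Qed.

Lemma bounded_op_submod : submod_closed bounded_op.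
Proof.
split.
  apply/bounded_opP; split; first by move=> c x y; rewrite /= scaler0 addr0.
  by exists 0 => x; rewrite mul0r rnorm0.
move=> c f g /bounded_opP[lf [M fM]] /bounded_opP[lg [N gN]].
apply/bounded_opP; split.
  move=> k x y; rewrite !fctE lf lg !scalerDr !scalerA (mulrC c k).
  by rewrite addrACA.
exists (Normc.normc c * M + N) => x.
rewrite !fctE (le_trans (rnormD _ _))// mulrDl lerD// rnormZ -mulrA.
by rewrite ler_wpM2l// normc_ge0.
Qed.

HB.instance Definition _ :=
  GRing.isSubmodClosed.Build _ _ bounded_op bounded_op_submod.

Record bop := Bop { bop_fun :> E -> E ; _ : bop_fun \in bounded_op }.

HB.instance Definition _ := [isSub for bop_fun].
HB.instance Definition _ := [Choice of bop by <:].
HB.instance Definition _ := [SubChoice_isSubLmodule of bop by <:].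
Implicit Types (f g : bop) (x : E).

Lemma bop_linear f : linear f.
Proof. by have /bounded_opP[] := valP f. Qed.

Lemma bopP f g : f =1 g -> f = g.
Proof. by move=> fg; apply/val_inj/funext. Qed.

Lemma bop_addE f g x : (f + g) x = f x + g x. Proof. by []. Qed.

Lemma bop_scaleE (c : R[i]) f x : (c *: f) x = c *: f x. Proof. by []. Qed.

Let unit_values f : set R := [set rnorm (f x) | x in [set x | rnorm x <= 1]].

Definition opnorm f : R := sup (unit_values f).

Lemma bop0 f : f 0 = 0.
Proof. by have := bop_linear f (-1) 0 0; rewrite scaler0 addr0 scaleN1r addNr. Qed.

Lemma bopZ f c x : f (c *: x) = c *: f x.
Proof. by have := bop_linear f c x 0; rewrite bop0 !addr0. Qed.

Lemma bopD f x y : f (x + y) = f x + f y.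
Proof. by have := bop_linear f 1 x y; rewrite !scale1r. Qed.

Lemma opnorm_has_sup f : has_sup (unit_values f).
Proof.
split; first by exists 0, 0; rewrite /= ?bop0 rnorm0.
have /bounded_opP[_ [M fM]] := valP f.
exists `|M| => _ [x /= x1 <-]; rewrite (le_trans (fM x))//.
rewrite (le_trans (ler_norm _))// normrM -[leRHS]mulr1 ler_wpM2l//.
by rewrite ger0_norm// rnorm_ge0.
Qed.

Lemma eopnormE f : eopnorm f = (opnorm f)%:E.
Proof.
rewrite /eopnorm -ereal_sup_EFin; [|exact: (opnorm_has_sup f).2|
  exact: (opnorm_has_sup f).1].
by rewrite image_comp.
Qed.

Lemma opnorm_ge0 f : 0 <= opnorm f.
Proof.
apply: (sup_upper_bound (opnorm_has_sup f)).
by exists 0; rewrite /= ?bop0 rnorm0.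
Qed.

Lemma rnorm_bop f x : rnorm (f x) <= opnorm f * rnorm x.
Proof.
have [x0|x0] := eqVneq (rnorm x) 0.
  by rewrite (rnorm_eq0 x0) bop0 rnorm0 mulr0.
have x_gt0 : 0 < rnorm x by rewrite lt_def x0 rnorm_ge0.
have nE : Normc.normc (rnorm x)^-1%:C = (rnorm x)^-1.
  by rewrite /= expr0n/= addr0 sqrtr_sqr ger0_norm// invr_ge0 ltW.
rewrite -ler_pdivrMr// mulrC -{1}nE -rnormZ -bopZ.
apply: (sup_upper_bound (opnorm_has_sup f)); eexists => //=.
by rewrite rnormZ nE mulVf.
Qed.

Lemma opnorm_le f (M : R) : 0 <= M ->
  (forall x, rnorm (f x) <= M * rnorm x) -> opnorm f <= M.
Proof.
move=> M0 fM; apply: ge_sup; first exact: (opnorm_has_sup f).1.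
move=> _ [x /= x1 <-]; rewrite (le_trans (fM x))// -[leRHS]mulr1.
exact: ler_wpM2l.
Qed.

Lemma opnormD f g : opnorm (f + g) <= opnorm f + opnorm g.
Proof.
apply: opnorm_le => [|x]; first by rewrite addr_ge0 ?opnorm_ge0.
by rewrite bop_addE (le_trans (rnormD _ _))// mulrDl lerD// rnorm_bop.
Qed.

Lemma opnormZ_le (c : R[i]) f : opnorm (c *: f) <= Normc.normc c * opnorm f.
Proof.
have c0 := normc_ge0 c.
apply: opnorm_le => [|x]; first by rewrite mulr_ge0 ?opnorm_ge0.
by rewrite bop_scaleE rnormZ -mulrA ler_wpM2l// rnorm_bop.
Qed.

Lemma opnormZ (c : R[i]) f : opnorm (c *: f) = Normc.normc c * opnorm f.
Proof.
apply/le_anti; rewrite opnormZ_le/=.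
have [->|c0] := eqVneq c 0; first by rewrite Normc.normc0 mul0r opnorm_ge0.
have nc0 : 0 < Normc.normc c.
  by rewrite lt_def normc_ge0 andbT; apply: contraNneq c0 => /Normc.eq0_normc ->.
rewrite -ler_pdivlMl// -Normc.normcV (le_trans _ (opnormZ_le _ _))//.
by rewrite scalerA mulVf// scale1r.
Qed.

Definition cnorm_bop f : R[i] := (opnorm f)%:C.

Lemma cnorm_bopD f g : cnorm_bop (f + g) <= cnorm_bop f + cnorm_bop g.
Proof. by rewrite /cnorm_bop -rmorphD/= lecR opnormD. Qed.

Lemma cnorm_bopZ (c : R[i]) f : cnorm_bop (c *: f) = `|c| * cnorm_bop f.
Proof. by rewrite /cnorm_bop opnormZ rmorphM. Qed.

Lemma cnorm_bop_eq0 f : cnorm_bop f = 0 -> f = 0.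
Proof.
move=> /complexI f0; apply: bopP => x; apply: rnorm_eq0; apply/le_anti.
by rewrite rnorm_ge0 andbT (le_trans (rnorm_bop _ _))// f0 mul0r.
Qed.

HB.instance Definition _ := Lmodule_isNormed.Build R[i] bop
  cnorm_bopD cnorm_bopZ cnorm_bop_eq0.

Lemma rnorm_opE f : rnorm f = opnorm f. Proof. by []. Qed.

Lemma bop_comp_subproof f g : f \o g \in bounded_op.
Proof.
apply/bounded_opP; split; first by move=> c x y; rewrite /= !bop_linear.
exists (opnorm f * opnorm g) => x.
by rewrite (le_trans (rnorm_bop _ _))// -mulrA ler_wpM2l ?opnorm_ge0 ?rnorm_bop.
Qed.

Definition bop_comp f g : bop := Bop (bop_comp_subproof f g).

Lemma bop_id_subproof : id \in bounded_op.
Proof. by apply/bounded_opP; split=> //; exists 1 => x; rewrite mul1r. Qed.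

Definition bop_id : bop := Bop bop_id_subproof.

Lemma bop_compA : associative bop_comp. Proof. by move=> f g h; apply: bopP. Qed.

Lemma bop_compDl : left_distributive bop_comp +%R.
Proof. by move=> f g h; apply: bopP. Qed.

Lemma bop_compDr : right_distributive bop_comp +%R.
Proof. by move=> f g h; apply: bopP => x; exact: (bopD f (g x) (h x)). Qed.

Lemma bop_compZl (c : R[i]) f g : bop_comp (c *: f) g = c *: bop_comp f g.
Proof. exact: bopP. Qed.

Lemma bop_compZr (c : R[i]) f g : bop_comp f (c *: g) = c *: bop_comp f g.
Proof. by apply: bopP => x; exact: (bopZ f c (g x)). Qed.

Lemma bop_comp_norm f g : `|bop_comp f g| <= `|f| * `|g|.
Proof.
rewrite -[leLHS]/((opnorm _)%:C) -[leRHS]/((opnorm f)%:C * (opnorm g)%:C).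
rewrite -rmorphM lecR; apply: opnorm_le => [|x].
  by rewrite mulr_ge0 ?opnorm_ge0.
by rewrite (le_trans (rnorm_bop f (g x)))// -mulrA ler_wpM2l ?opnorm_ge0 ?rnorm_bop.
Qed.

HB.instance Definition _ := NormedModule_isNormedAlgebra.Build R[i] bop
  bop_compA bop_compDl bop_compDr bop_compZl bop_compZr bop_comp_norm.

End bounded_operators.
Arguments bop_id {R} E.

Section complex_Lp.
Context {R : realType} {d : measure_display} {X : measurableType d}.
Variable mu : {measure set X -> \bar R}.

Definition cmeasurable (f : X -> R[i]) :=
  measurable_fun setT (fun x => complex.Re (f x)) /\
  measurable_fun setT (fun x => complex.Im (f x)).

Let cabs (f : X -> R[i]) (x : X) : R := Normc.normc (f x).

Let normcE (c : R[i]) :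
  Normc.normc c = Num.sqrt (complex.Re c ^+ 2 + complex.Im c ^+ 2).
Proof. by case: c. Qed.

Let measurable_cabs f : cmeasurable f -> measurable_fun setT (cabs f).
Proof.
move=> [mr mi]; rewrite (_ : cabs f =
    Num.sqrt \o (fun x => complex.Re (f x) ^+ 2 + complex.Im (f x) ^+ 2)).
  apply: measurableT_comp.
    apply: continuous_measurable_fun; exact: sqrt_continuous.
  by apply: measurable_funD; exact: measurable_funX.
by apply/funext => x; rewrite /cabs normcE.
Qed.

Lemma cmeasurable0 : cmeasurable 0.
Proof. by split; exact: measurable_cst. Qed.

Lemma cmeasurable_lin (c : R[i]) f g :
  cmeasurable f -> cmeasurable g -> cmeasurable (c *: f + g).
Proof.
move=> [fr fi] [gr gi]; split.
  rewrite (_ : (fun _ => _) = fun x => (complex.Re c * complex.Re (f x)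
      - complex.Im c * complex.Im (f x)) + complex.Re (g x)).
    apply: measurable_funD => //; apply: measurable_funB;
    exact: measurable_funM.
  by apply/funext => x; rewrite !fctE; case: c (f x) (g x) => [? ?] [? ?] [? ?].
rewrite (_ : (fun _ => _) = fun x => (complex.Re c * complex.Im (f x)
    + complex.Im c * complex.Re (f x)) + complex.Im (g x)).
  apply: measurable_funD => //; apply: measurable_funD;
  exact: measurable_funM.
by apply/funext => x; rewrite !fctE; case: c (f x) (g x) => [? ?] [? ?] [? ?].
Qed.

Variables (p : R) (p1 : 1 <= p).

Let p_gt0 : 0 < p. Proof. exact: lt_le_trans p1. Qed.

Definition cLnorm (f : X -> R[i]) : \bar R :=
  'N[mu]_p%:E[EFin \o (@Normc.normc R \o f)].

Let cLnorm_eq (f : X -> R[i]) :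
  cLnorm f = ((\int[mu]_x ((cabs f x) `^ p)%:E) `^ p^-1)%E.
Proof.
rewrite /cLnorm unlock; congr (_ `^ _)%E; apply: eq_integral => x _.
by rewrite /= ger0_norm// normc_ge0.
Qed.

Lemma cLnorm_ge0 f : (0 <= cLnorm f)%E. Proof. exact: Lnorm_ge0. Qed.

Let measurable_powcabs f : cmeasurable f ->
  measurable_fun setT (fun x => ((cabs f x) `^ p)%:E).
Proof.
move=> mf; apply/measurable_EFinP.
exact: (measurableT_comp (measurable_powR p) (measurable_cabs mf)).
Qed.

Lemma cLnorm0 : cLnorm 0 = 0%E.
Proof.
rewrite cLnorm_eq; under eq_integral.
  by move=> x _; rewrite /cabs Normc.normc0 powR0 ?gt_eqF//; over.
by rewrite integral0 poweR0r// invr_neq0// gt_eqF.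
Qed.

Lemma cLnormD f g : cmeasurable f -> cmeasurable g ->
  (cLnorm (f + g)%R <= cLnorm f + cLnorm g)%E.
Proof.
move=> mf mg.
have := eminkowski mu (measurable_cabs mf) (measurable_cabs mg)
  (p1 : 1 <= p%:E)%E.
apply: le_trans; rewrite cLnorm_eq unlock.
rewrite gt0_ler_poweR ?invr_ge0 ?(ltW p_gt0)//.
- by rewrite in_itv/= leey andbT integral_ge0// => x _; rewrite lee_fin powR_ge0.
- by rewrite in_itv/= leey andbT integral_ge0// => x _; rewrite lee_fin powR_ge0.
have mfg : cmeasurable (f + g).
  by have := cmeasurable_lin 1 mf mg; rewrite scale1r.
apply: ge0_le_integral => //.
- by move=> x _; rewrite lee_fin powR_ge0.
- exact: measurable_powcabs.
- apply/measurable_EFinP; apply: (measurableT_comp (measurable_powR p)).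
  apply: measurableT_comp => //.
  exact: measurable_funD (measurable_cabs mf) (measurable_cabs mg).
move=> x _; rewrite lee_fin ge0_ler_powR ?nnegrE ?normc_ge0 ?(ltW p_gt0)//.
rewrite /= ger0_norm ?addr_ge0 ?normc_ge0//.
exact: normcD.
Qed.

Lemma cLnormZ (c : R[i]) f : cmeasurable f ->
  cLnorm (c *: f) = ((Normc.normc c)%:E * cLnorm f)%E.
Proof.
move=> mf; rewrite !cLnorm_eq.
under eq_integral.
  by move=> x _; rewrite /cabs fctE Normc.normcM powRM ?normc_ge0// EFinM; over.
rewrite /= ge0_integralZl_EFin ?powR_ge0//; last 2 first.
- by move=> x _; rewrite lee_fin powR_ge0.
- exact: measurable_powcabs.
rewrite poweRM ?lee_fin ?powR_ge0 ?integral_ge0//; last first.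
  by move=> x _; rewrite lee_fin powR_ge0.
by rewrite poweR_EFin -powRrM mulfV ?gt_eqF// powRr1// normc_ge0.
Qed.

Lemma cLnorm_ae f g : cmeasurable f -> cmeasurable g ->
  f = g %[ae mu] -> cLnorm f = cLnorm g.
Proof.
move=> mf mg fg; rewrite !cLnorm_eq; congr (_ `^ _)%E.
apply: ae_eq_integral => //; [exact: measurable_powcabs..|].
by apply: filterS fg => x fg Tx; rewrite /cabs fg.
Qed.

Lemma cLnorm_eq0 f : cmeasurable f -> cLnorm f = 0%E -> f = 0 %[ae mu].
Proof.
move=> mf /Lnorm_eq0_eq0 f0.
have /f0 : measurable_fun setT (fun x => (Normc.normc (f x))%:E).
  by apply/measurable_EFinP; exact: measurable_cabs.
move=> /(_ p_gt0); apply: filterS => x /(_ I) [fx0] _.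
exact: Normc.eq0_normc.
Qed.

(* [1 <= p] is a parameter because the structures below are only available
   under this condition. *)
Definition Lp_fun of 1 <= p : {pred X -> R[i]} :=
  mem [set f | cmeasurable f /\ (cLnorm f < +oo)%E].

Lemma Lp_funP f : f \in Lp_fun p1 <-> cmeasurable f /\ (cLnorm f < +oo)%E.
Proof. by rewrite in_setE. Qed.

Lemma Lp_fun_submod : submod_closed (Lp_fun p1).
Proof.
split; first by apply/Lp_funP; split; [exact: cmeasurable0|rewrite cLnorm0].
move=> c f g /Lp_funP[mf fy] /Lp_funP[mg gy]; apply/Lp_funP.
split; first exact: cmeasurable_lin.
have mcf : cmeasurable (c *: f).
  by have := cmeasurable_lin c mf cmeasurable0; rewrite addr0.
rewrite (le_lt_trans (cLnormD _ _))//.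
by rewrite lte_add_pinfty// cLnormZ// lte_mul_pinfty// lee_fin normc_ge0.
Qed.

End complex_Lp.

Section Lp_space.
Context {R : realType} (p : R) (p1 : 1 <= p).
Context {d : measure_display} {X : measurableType d}.
Variable mu : {measure set X -> \bar R}.

HB.instance Definition _ :=
  GRing.isSubmodClosed.Build _ _ (Lp_fun mu p1) (Lp_fun_submod mu p1).

Record Lpf := MkLpf { lpf_fun :> X -> R[i] ; _ : lpf_fun \in Lp_fun mu p1 }.

HB.instance Definition _ := [isSub for lpf_fun].
HB.instance Definition _ := [Choice of Lpf by <:].
HB.instance Definition _ := [SubChoice_isSubLmodule of Lpf by <:].
Implicit Types f g : Lpf.

Let mLpf f : cmeasurable f. Proof. by have /Lp_funP[] := valP f. Qed.

Definition ae_eq_Lpf : rel Lpf :=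
  fun f g => `[< (f : X -> R[i]) = g %[ae mu] >].

Lemma ae_eq_Lpf_refl : reflexive ae_eq_Lpf.
Proof. by move=> f; apply/asboolP; exact: ae_eq_refl. Qed.

Lemma ae_eq_Lpf_sym : symmetric ae_eq_Lpf.
Proof. by move=> f g; apply/asboolP/asboolP; exact: ae_eq_sym. Qed.

Lemma ae_eq_Lpf_trans : transitive ae_eq_Lpf.
Proof.
by move=> g f h /asboolP fg /asboolP gh; apply/asboolP; exact: ae_eq_trans fg gh.
Qed.

Canonical ae_eq_Lpf_equiv :=
  EquivRel ae_eq_Lpf ae_eq_Lpf_refl ae_eq_Lpf_sym ae_eq_Lpf_trans.

Local Open Scope quotient_scope.

(* L^p(X, mu) with complex scalars: classes of p-integrable functions modulo
   almost everywhere equality. *)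
Definition Lp : Type := {eq_quot ae_eq_Lpf}.
HB.instance Definition _ := Choice.on Lp.
HB.instance Definition _ := EqQuotient.on Lp.

Lemma Lp_eqP f g : \pi_Lp f = \pi_Lp g <-> (f : X -> R[i]) = g %[ae mu].
Proof. by split=> [/eqmodP/asboolP//|fg]; apply/eqmodP/asboolP. Qed.

Let Lp_reprP f : (repr (\pi_Lp f) : X -> R[i]) = f %[ae mu].
Proof. by apply/Lp_eqP; rewrite reprK. Qed.

Definition Lp_add (u v : Lp) : Lp := \pi_Lp (repr u + repr v).
Definition Lp_opp (u : Lp) : Lp := \pi_Lp (- repr u).
Definition Lp_scale (c : R[i]) (u : Lp) : Lp := \pi_Lp (c *: repr u).

Let Lp_addE f g : Lp_add (\pi_Lp f) (\pi g) = \pi_Lp (f + g).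
Proof.
apply/Lp_eqP; apply: filterS2 (Lp_reprP f) (Lp_reprP g) => x fE gE Tx.
by rewrite /= !fctE fE// gE.
Qed.

Let Lp_oppE f : Lp_opp (\pi_Lp f) = \pi_Lp (- f).
Proof. by apply/Lp_eqP; apply: filterS (Lp_reprP f) => x fE Tx; rewrite /= !fctE fE. Qed.

Let Lp_scaleE c f : Lp_scale c (\pi_Lp f) = \pi_Lp (c *: f).
Proof. by apply/Lp_eqP; apply: filterS (Lp_reprP f) => x fE Tx; rewrite /= !fctE fE. Qed.

Let Lp_addA : associative Lp_add.
Proof. by move=> u v w; elim/quotW: u => f; elim/quotW: v => g; elim/quotW: w => h; rewrite (Lp_addE g h) (Lp_addE f (g + h)) (Lp_addE f g) (Lp_addE (f + g) h) addrA. Qed.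

Let Lp_addC : commutative Lp_add.
Proof. by move=> u v; elim/quotW: u => f; elim/quotW: v => g; rewrite (Lp_addE f g) (Lp_addE g f) addrC. Qed.

Let Lp_add0 : left_id (\pi_Lp 0) Lp_add.
Proof. by move=> u; elim/quotW: u => f; rewrite (Lp_addE 0 f) add0r. Qed.

Let Lp_addN : left_inverse (\pi_Lp 0) Lp_opp Lp_add.
Proof. by move=> u; elim/quotW: u => f; rewrite (Lp_oppE f) (Lp_addE (- f) f) addNr. Qed.

HB.instance Definition _ :=
  GRing.isZmodule.Build Lp Lp_addA Lp_addC Lp_add0 Lp_addN.

Let Lp_scaleA a b u : Lp_scale a (Lp_scale b u) = Lp_scale (a * b) u.
Proof. by elim/quotW: u => f; rewrite (Lp_scaleE b f) (Lp_scaleE a (b *: f)) (Lp_scaleE (a * b) f) scalerA. Qed.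

Let Lp_scale1 : left_id 1 Lp_scale.
Proof. by move=> u; elim/quotW: u => f; rewrite (Lp_scaleE 1 f) scale1r. Qed.

Let Lp_scaleDr : right_distributive Lp_scale +%R.
Proof.
move=> c u v; elim/quotW: u => f; elim/quotW: v => g.
rewrite [X in Lp_scale c X](Lp_addE f g) (Lp_scaleE c (f + g)).
by rewrite (Lp_scaleE c f) (Lp_scaleE c g) scalerDr; exact/esym/Lp_addE.
Qed.

Let Lp_scaleDl u : {morph Lp_scale^~ u : a b / a + b}.
Proof.
elim/quotW: u => f a b.
rewrite (Lp_scaleE (a + b) f) (Lp_scaleE a f) (Lp_scaleE b f) scalerDl.
exact/esym/Lp_addE.
Qed.

HB.instance Definition _ := GRing.Zmodule_isLmodule.Build R[i] Lp
  Lp_scaleA Lp_scale1 Lp_scaleDr Lp_scaleDl.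

Definition Lp_norm (u : Lp) : R[i] := (fine (cLnorm mu p (repr u)))%:C.

Lemma Lp_normE f : Lp_norm (\pi_Lp f) = (fine (cLnorm mu p f))%:C.
Proof. by congr ((fine _)%:C); apply: cLnorm_ae. Qed.

Let cLnorm_fin f : cLnorm mu p f \is a fin_num.
Proof. by rewrite ge0_fin_numE ?cLnorm_ge0//; have /Lp_funP[] := valP f. Qed.

Lemma Lp_normD u v : Lp_norm (u + v) <= Lp_norm u + Lp_norm v.
Proof.
elim/quotW: u => f; elim/quotW: v => g.
rewrite [X in Lp_norm X](Lp_addE f g) (Lp_normE (f + g)) (Lp_normE f) (Lp_normE g) -rmorphD lecR.
by rewrite -lee_fin EFinD !fineK//; exact: cLnormD.
Qed.

Lemma Lp_normZ (c : R[i]) u : Lp_norm (c *: u) = `|c| * Lp_norm u.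
Proof.
elim/quotW: u => f; rewrite [X in Lp_norm X](Lp_scaleE c f) (Lp_normE (c *: f)) (Lp_normE f).
rewrite -[`|c|]/((Normc.normc c)%:C) -rmorphM; congr (_%:C).
by rewrite -[RHS]/(fine (_%:E)) EFinM fineK//; congr fine; exact: cLnormZ.
Qed.

Lemma Lp_norm_eq0 u : Lp_norm u = 0 -> u = 0.
Proof.
elim/quotW: u => f; rewrite Lp_normE => /complexI f0.
apply/Lp_eqP; apply: (@cLnorm_eq0 _ _ _ _ p) => //.
by rewrite -[LHS]fineK// f0.
Qed.

HB.instance Definition _ := Lmodule_isNormed.Build R[i] Lp
  Lp_normD Lp_normZ Lp_norm_eq0.

End Lp_space.
Arguments Lp {R p} p1 {d X} mu.

Section bochner_integral.
Context {R : realType} {d : measure_display} {X : measurableType d}.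
Variables (mu : {measure set X -> \bar R}) (E : normedModType R[i]).

(* Vector-valued simple functions, as finite sums of weighted indicators. *)
Record simple_vfun := SimpleVfun {
  sv_size : nat ;
  sv_set : 'I_sv_size -> set X ;
  sv_val : 'I_sv_size -> E ;
  sv_measurable : forall i, measurable (sv_set i) ;
  sv_finite : forall i, (mu (sv_set i) < +oo)%E
}.

Definition sv_fun (s : simple_vfun) (x : X) : E :=
  \sum_i (\1_(sv_set i) x : R)%:C *: sv_val (s := s) i.

Definition sv_integral (s : simple_vfun) : E :=
  \sum_i (fine (mu (sv_set i)))%:C *: sv_val (s := s) i.

Definition is_bochner_integral (f : X -> E) (y : E) := exists s : simple_vfun^nat,
  [/\ forall n, measurable_fun setT (fun x => rnorm (f x - sv_fun (s n) x)),
      (\int[mu]_x (rnorm (f x - sv_fun (s n) x))%:E @[n --> \oo] --> 0)%E &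
      sv_integral (s n) @[n --> \oo] --> y].

(* Bochner integral, with value 0 when [f] is not Bochner integrable. *)
Definition bochner (f : X -> E) : E := xget 0 (is_bochner_integral f).

End bochner_integral.

Section borel_haar.

Definition borel (G : topologicalType) : Type := G.

Context (G : topologicalZmodType).
Implicit Types (g : G) (U K : set G).

HB.instance Definition _ := Choice.on (borel G).
HB.instance Definition _ := isPointed.Build (borel G) (0 : G).

Lemma borel_setC (A : set (borel G)) : <<s @open G >> A -> <<s @open G >> (~` A).
Proof. by move=> sA; rewrite -setTD; exact: sigma_algebraCD. Qed.

HB.instance Definition _ := @isMeasurable.Build (sigma_display (@open G))
  (borel G) <<s @open G >> (@sigma_algebra0 _ setT (@open G)) borel_setC
  (@sigma_algebra_bigcup _ setT (@open G)).

(* Haar measures: nonzero translation invariant Radon measures. *)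
Record haar_measure {R : realType} (nu : {measure set (borel G) -> \bar R}) :
    Prop := {
  haar_neq0 : nu setT != 0%E ;
  haar_invariant : forall g (A : set (borel G)), measurable A ->
    nu [set g + x | x in (A : set G)] = nu A ;
  haar_compact : forall K, compact K -> (nu K < +oo)%E ;
  haar_outer_regular : forall A : set (borel G), measurable A ->
    nu A = ereal_inf [set nu U | U in [set U | open U /\ A `<=` U]] ;
  haar_inner_regular : forall U, open U ->
    nu U = ereal_sup [set nu K | K in [set K | compact K /\ K `<=` U]]
}.

(* Abelian groups are written additively. *)
Definition second_countable_lca :=
  [/\ hausdorff_space G, locally_compact [set: G] & @second_countable G].

End borel_haar.

Section pontryagin_dual.
Context (R : realType) (G : topologicalZmodType).

Definition is_character (t : G -> R[i]) :=
  [/\ continuous (t : G -> R[i]^o), {morph t : g h / g + h >-> g * h} &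
      forall g, `|t g| = 1].

Definition characters : {pred G -> R[i]} := mem [set t | is_character t].

Record dual_group :=
  DualGroup { character :> G -> R[i] ; _ : character \in characters }.

HB.instance Definition _ := [isSub for character].
HB.instance Definition _ := [Choice of dual_group by <:].
Implicit Types (s t : dual_group) (g : G).

Lemma characterP t : is_character t.
Proof. by have := valP t; rewrite in_setE. Qed.

Lemma characterD t g h : t (g + h) = t g * t h.
Proof. by case: (characterP t). Qed.

Lemma character_norm t g : `|t g| = 1.
Proof. by case: (characterP t). Qed.

Lemma character_continuous t : continuous (t : G -> R[i]^o).
Proof. by case: (characterP t). Qed.

Lemma dual_eqP s t : s =1 t -> s = t.
Proof. by move=> st; apply/val_inj/funext. Qed.

Lemma is_character1 : is_character (fun=> 1).
Proof.
split; [exact: cst_continuous|by move=> g h; rewrite mulr1|].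
by move=> g; rewrite normr1.
Qed.

Lemma is_characterM s t : is_character (fun g => s g * t g).
Proof.
split.
- by move=> g; apply: (@cvgM R[i]); exact: character_continuous.
- by move=> g h; rewrite !characterD mulrACA.
- by move=> g; rewrite normrM !character_norm mulr1.
Qed.

Lemma conjc_norm (c : R[i]) : `|c^*| = `|c|.
Proof. by case: c => a b; rewrite /Num.norm/= sqrrN. Qed.

Lemma is_characterJ t : is_character (fun g => (t g)^*).
Proof.
split.
- move=> g; apply/cvgrPdist_lt => e e0.
  have /cvgrPdist_lt/(_ e e0) := @character_continuous t g.
  by apply: filterS => h; rewrite -rmorphB conjc_norm.
- by move=> g h; rewrite characterD rmorphM.
- by move=> g; rewrite conjc_norm character_norm.
Qed.

Definition dual1 := DualGroup (mem_set is_character1).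
Definition dualM s t := DualGroup (mem_set (is_characterM s t)).
Definition dualJ t := DualGroup (mem_set (is_characterJ t)).

Lemma dualMA : associative dualM.
Proof. by move=> r s t; apply: dual_eqP => g; rewrite /= mulrA. Qed.

Lemma dualMC : commutative dualM.
Proof. by move=> s t; apply: dual_eqP => g; rewrite /= mulrC. Qed.

Lemma dual1M : left_id dual1 dualM.
Proof. by move=> t; apply: dual_eqP => g; rewrite /= mul1r. Qed.

Lemma characterJK t g : (t g)^* * t g = 1.
Proof.
have := character_norm t g; case: (t g) => a b [] abE.
have {}abE : a ^+ 2 + b ^+ 2 = 1.
  by rewrite -[LHS]sqr_sqrtr ?addr_ge0 ?sqr_ge0// abE expr1n.
by congr (_ +i* _); rewrite ?mulNr ?opprK -?expr2// [b * a]mulrC subrr.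
Qed.

Lemma dualJM : left_inverse dual1 dualJ dualM.
Proof. by move=> t; apply: dual_eqP => g; exact: characterJK. Qed.

(* The group law of the dual is the pointwise product, written additively. *)
HB.instance Definition _ :=
  GRing.isZmodule.Build dual_group dualMA dualMC dual1M dualJM.

Lemma dual_addE s t g : (s + t) g = s g * t g. Proof. by []. Qed.
Lemma dual_oppE t g : (- t) g = (t g)^*. Proof. by []. Qed.

HB.instance Definition _ := Topological.copy dual_group
  (initial_topology (character : dual_group -> {compact-open, G -> R[i]^o})).

Lemma dual_cvgP (F : set_system dual_group) t : Filter F ->
  F --> t <-> forall K : set G, compact K -> forall e : R[i], 0 < e ->
    F [set s : dual_group | forall g, K g -> `|t g - s g| < e].
Proof.
move=> FF.
have tc : continuous (t : G -> R[i]^o) := @character_continuous t.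
have -> : F --> t <->
    {compact-open, ((fun s : dual_group => s : G -> R[i]^o) @ F) --> (t : G -> R[i]^o)}.
  split=> [Ft|Ft].
    apply: cvg_trans; first exact: (cvg_app _ Ft).
    exact: (@initial_continuous _ _
      (character : dual_group -> {compact-open, G -> R[i]^o})).
  move=> U /= [_ [[V Vo <-] Vt VU]].
  by apply: filterS VU _; apply: Ft; exact: open_nbhs_nbhs.
rewrite (@compact_open_fam_compactP G R[i]^o)//.
split.
  move=> /fam_cvgP Ft K cK e e0.
  have : nbhs (t : {uniform` K -> R[i]^o})
      [set s : G -> R[i]^o | forall g, K g -> `|t g - s g| < e].
    apply/uniform_nbhs; exists [set xy | `|xy.1 - xy.2| < e]; split=> //.
    by rewrite -entourage_from_ballE; exists e => //= -[x y]; rewrite -ball_normE.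
  exact: (Ft K cK).
move=> Ft; apply/fam_cvgP => K cK U /uniform_nbhs[V []].
rewrite -entourage_from_ballE => -[e e0 eV] VU.
suff : F [set s : dual_group | U (character s)] by [].
apply: (filterS _ (Ft K cK e e0)) => s sK; apply: VU => g Kg.
by apply: eV; rewrite /= -ball_normE; exact: sK.
Qed.

Lemma dual_sub_continuous :
  continuous (fun st : dual_group * dual_group => st.1 - st.2).
Proof.
move=> [s t]; apply/dual_cvgP => K cK e e0.
have e20 : 0 < e / 2 by rewrite divr_gt0.
have /dual_cvgP/(_ K cK _ e20) sK : nbhs s --> s by [].
have /dual_cvgP/(_ K cK _ e20) tK : nbhs t --> t by [].
exists ([set s' : dual_group | forall g, K g -> `|s g - s' g| < e / 2],
        [set t' : dual_group | forall g, K g -> `|t g - t' g| < e / 2]) => //=.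
move=> [s' t'] /= [sK' tK'] g Kg.
rewrite -[X in `|X|]/(s g * (t g)^* - s' g * (t' g)^*).
rewrite -[X in `|X|](subrKA (s' g * (t g)^*)) -mulrBl -mulrBr.
rewrite (le_lt_trans (ler_normD _ _))// !normrM -rmorphB !conjc_norm.
by rewrite !character_norm mulr1 mul1r (splitr e) ltrD ?sK' ?tK'.
Qed.

HB.instance Definition _ :=
  PreTopologicalNmodule_isTopologicalZmodule.Build dual_group dual_sub_continuous.

End pontryagin_dual.

Section compactly_supported_functions.
Context {R : realType} (G : topologicalZmodType) (A : normedModType R[i]).

Definition Cc_fun : {pred G -> A} := mem
  [set f | continuous f /\ compact (closure [set g | f g != 0])].

Lemma Cc_funP f : f \in Cc_fun <->
  continuous f /\ compact (closure [set g | f g != 0]).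
Proof. by rewrite in_setE. Qed.

Let Cc_sub (K : set G) (f : G -> A) :
  compact K -> closed K -> (forall g, ~ K g -> f g = 0) ->
  compact (closure [set g | f g != 0]).
Proof.
move=> cK clK fK; apply: (subclosed_compact _ cK); first exact: closed_closure.
rewrite [X in _ `<=` X](closure_id _).1//; apply: closure_subset => g /= fg0.
by apply: contrapT => /fK fg; rewrite fg eqxx in fg0.
Qed.

Lemma Cc_fun_submod : submod_closed Cc_fun.
Proof.
split.
  apply/Cc_funP; split; first exact: cst_continuous.
  by apply: (Cc_sub (K := set0)) => //; [exact: compact0|exact: closed0].
move=> c f g /Cc_funP[fc fK] /Cc_funP[gc gK]; apply/Cc_funP; split.
  by move=> x; apply: cvgD; [apply: cvgZr; exact: fc|exact: gc].
apply: (Cc_sub (compactU fK gK)); first by apply: closedU; exact: closed_closure.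
move=> x /not_orP[fx gx]; rewrite !fctE.
have [->|fx0] := eqVneq (f x) 0; last by case: fx; exact: subset_closure.
have [->|gx0] := eqVneq (g x) 0; last by case: gx; exact: subset_closure.
by rewrite scaler0 addr0.
Qed.

HB.instance Definition _ := GRing.isSubmodClosed.Build _ _ Cc_fun Cc_fun_submod.

Record Cc := MkCc { cc_fun :> G -> A ; _ : cc_fun \in Cc_fun }.

HB.instance Definition _ := [isSub for cc_fun].
HB.instance Definition _ := [Choice of Cc by <:].
HB.instance Definition _ := [SubChoice_isSubLmodule of Cc by <:].

Lemma cc_dual_subproof (t : dual_group R G) (a : Cc) :
  (fun g => (t g)^* *: a g) \in Cc_fun.
Proof.
have /Cc_funP[ac aK] := valP a; apply/Cc_funP; split.
  move=> g; apply: (@cvgZ R[i] A); last exact: ac.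
  exact: (@character_continuous _ _ (- t)).
apply: (Cc_sub aK); first exact: closed_closure.
move=> g ag; have [->|ag0] := eqVneq (a g) 0; first by rewrite scaler0.
by case: ag; exact: subset_closure.
Qed.

Definition cc_dual (t : dual_group R G) (a : Cc) : Cc :=
  MkCc (cc_dual_subproof t a).

End compactly_supported_functions.

Section actions_and_representations.
Context {R : realType}.

Definition alg_hom {A B : normedAlgType R[i]} (phi : A -> B) :=
  linear phi /\ {morph phi : a b / a ** b}.

(* Continuity of the inverse of [beta h] is automatic: it is [beta (- h)]. *)
Definition continuous_action {H : topologicalZmodType} {B : normedAlgType R[i]}
    (beta : H -> B -> B) :=
  [/\ forall h, [/\ alg_hom (beta h), bijective (beta h) & continuous (beta h)],
      forall b, beta 0 b = b,
      forall h k b, beta (h + k) b = beta h (beta k b) &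
      forall b, continuous (fun h => beta h b)].

Definition isometric_action {H : topologicalZmodType} {B : normedAlgType R[i]}
    (beta : H -> B -> B) := forall h b, `|beta h b| = `|b|.

Section representations.
Context {A : normedAlgType R[i]} {E : normedModType R[i]} (pi : A -> bop E).

Definition representation := alg_hom pi /\ continuous pi.

Definition contractive_rep := forall a, `|pi a| <= `|a|.

Definition isometric_rep := forall a, `|pi a| = `|a|.

Definition nondegenerate_rep := closure
  [set y : E | exists n (c : 'I_n -> R[i]) (a : 'I_n -> A) (xi : 'I_n -> E),
    y = \sum_i c i *: pi (a i) (xi i)] = setT.

End representations.

Section Lp_algebras.
Context {p : R} (p1 : 1 <= p) (A : banachAlgType R[i]).

(* A is isometrically isomorphic to the norm closed subalgebra [range pi]. *)
Definition Lp_operator_algebra :=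
  exists (d : measure_display) (X : measurableType d)
    (mu : {measure set X -> \bar R}) (pi : A -> bop (Lp p1 mu)),
  [/\ representation pi, isometric_rep pi & closed (range pi)].

Definition nondeg_sigma_finitely_representable :=
  exists (d : measure_display) (X : measurableType d)
    (mu : {measure set X -> \bar R}) (pi : A -> bop (Lp p1 mu)),
  [/\ sigma_finite setT mu, representation pi, isometric_rep pi &
      nondegenerate_rep pi].

End Lp_algebras.

Context {G : topologicalZmodType} {A : banachAlgType R[i]} (alpha : G -> A -> A).

(* [v (- g)] is the inverse of [v g] by the first two clauses. *)
Definition covariant_rep {E : normedModType R[i]} (v : G -> bop E)
    (pi : A -> bop E) :=
  [/\ v 0 = bop_id E,
      forall g h, v (g + h) = v g ** v h,
      forall xi, continuous (fun g => v g xi),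
      representation pi &
      forall g a, pi (alpha g a) = v g ** pi a ** v (- g)].

Definition contractive_covariant {E : normedModType R[i]} (v : G -> bop E)
    (pi : A -> bop E) := (forall g, `|v g| <= 1) /\ contractive_rep pi.

Variable nu : {measure set (borel G) -> \bar R}.

Definition integrated_form {E : normedModType R[i]} (v : G -> bop E)
    (pi : A -> bop E) (a : Cc G A) (xi : E) : E :=
  bochner nu (fun g : borel G => pi (a g) (v g xi)).

(* The twisted convolution of [a] and [b] (which is again in C_c). *)
Definition cc_conv (a b : Cc G A) : Cc G A := xget 0 [set c : Cc G A |
  forall g, c g = bochner nu (fun h : borel G => a h ** alpha h (b (g - h)))].

Context {p : R} (p1 : 1 <= p).

Definition crossed_seminorm (a : Cc G A) : \bar R := ereal_sup
  [set x | exists (d : measure_display) (X : measurableType d)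
      (mu : {measure set X -> \bar R})
      (v : G -> bop (Lp p1 mu)) (pi : A -> bop (Lp p1 mu)),
    [/\ sigma_finite setT mu, covariant_rep v pi, contractive_covariant v pi,
        nondegenerate_rep pi & x = eopnorm (integrated_form v pi a)]].

(* [F] with the map [iota] is the full crossed product: the Hausdorff
   completion of C_c(G, A, alpha) for the above seminorm. It is determined by
   these properties up to a unique isometric isomorphism compatible with
   [iota]. *)
Definition full_crossed_product (F : banachAlgType R[i]) (iota : Cc G A -> F) :=
  [/\ linear iota,
      forall a b, iota (cc_conv a b) = iota a ** iota b,
      closure (range iota) = setT &
      forall a, (rnorm (iota a))%:E = crossed_seminorm a].

End actions_and_representations.

(* Main.v *)
Require Import Defs.
From mathcomp Require Import all_boot all_order all_algebra complex.
From mathcomp Require Import all_classical all_reals all_analysis.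
From mathcomp Require Import measurable_realfun lra.

(* If (v, pi) is a contractive covariant representation and t is a character of
   G, then so is (conj(t) v, pi), and its integrated form at a is that of
   (v, pi) at g |-> conj(t(g)) a(g).  Hence the dual action preserves the
   seminorm of C_c(G, A, alpha), and it extends by density to isometries of F.
   It is multiplicative because conj(t(h)) conj(t(g - h)) = conj(t(g)) inside
   the convolution integral.  Its strong continuity follows from the bound of
   the seminorm of a function supported in a compact set K by its supremum norm
   times nu(K), since t |-> t(g) is continuous uniformly on K. *)

Set Implicit Arguments.
Unset Strict Implicit.
Unset Printing Implicit Defensive.

Import Order.TTheory GRing.Theory Num.Theory.
Import numFieldNormedType.Exports.

Local Open Scope classical_set_scope.
Local Open Scope complex_scope.
Local Open Scope ring_scope.

(** * Elementary inequalities for the real-valued norm *)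

Section real_norm_facts.
Context {R : realType} {E : normedModType R[i]}.

Lemma rnormB (x y : E) : rnorm (x - y) = rnorm (y - x).
Proof. by apply: complexI; rewrite -!rnormE distrC. Qed.

Lemma rnorm_sum (I : Type) (r : seq I) (P : pred I) (x : I -> E) :
  rnorm (\sum_(i <- r | P i) x i) <= \sum_(i <- r | P i) rnorm (x i).
Proof.
elim/big_ind2: _ => [|a u b v au bv|//]; first by rewrite rnorm0.
by rewrite (le_trans (rnormD _ _))// lerD.
Qed.

Lemma rnorm_lt (x : E) (e : R) : (`|x| < e%:C) = (rnorm x < e).
Proof. by rewrite rnormE ltcR. Qed.

End real_norm_facts.

(** * Vector-valued simple functions and their integrals *)

Section simple_functions.
Context {R : realType} {d : measure_display} {X : measurableType d}.
Variables (mu : {measure set X -> \bar R}) (E : normedModType R[i]).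
Implicit Types s : simple_vfun mu E.

(** The sets [sv_set] of a simple function may overlap. The fibres of [sv_pattern] are the atoms of
    the finite algebra that they generate: they partition [X], and the function is constant on
    each. *)
Definition sv_pattern s (x : X) : {set 'I_(sv_size s)} :=
  [set i | x \in sv_set (s := s) i]%SET.

Definition sv_atom s (J : {set 'I_(sv_size s)}) : set X :=
  [set x | sv_pattern s x = J].

Definition sv_atom_val s (J : {set 'I_(sv_size s)}) : E :=
  \sum_(i in J) sv_val (s := s) i.

Lemma measurable_sv_atom s J : measurable (sv_atom (s := s) J).
Proof.
have -> : sv_atom J = \bigcap_(i in [set: 'I_(sv_size s)])
    (if i \in J then sv_set (s := s) i else ~` sv_set (s := s) i).
  apply/seteqP; split=> [x <- i _|x xJ] /=.
    rewrite inE; case: ifPn => [/set_mem//|/negP xi xA].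
    by apply: xi; exact: mem_set.
  apply/setP => i; rewrite inE; have := xJ i I.
  by case: ifPn => iJ xi; [exact: mem_set|exact: memNset].
apply: fin_bigcap_measurable; first exact: finite_finset.
by move=> i _; case: ifP => _; [|apply: measurableC]; exact: sv_measurable.
Qed.

Lemma sum_sv_atom s (f : {set 'I_(sv_size s)} -> R) x :
  \sum_J f J * \1_(sv_atom J) x = f (sv_pattern s x).
Proof.
rewrite (bigD1 (sv_pattern s x))//= big1 ?addr0.
  by rewrite indicE mem_set// mulr1.
by move=> J Jx; rewrite indicE memNset ?mulr0// => xJ; rewrite -xJ eqxx in Jx.
Qed.

Lemma integral_sum_sv_atom s (f : {set 'I_(sv_size s)} -> R) :
  (forall J, 0 <= f J) ->
  (\int[mu]_x (f (sv_pattern s x))%:E = \sum_J (f J)%:E * mu (sv_atom J))%E.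
Proof.
move=> f0; under eq_integral do rewrite -sum_sv_atom -sumEFin.
rewrite ge0_integral_sum//; last 2 first.
- move=> J; apply/measurable_EFinP; apply: measurable_funM => //.
  exact/measurable_indicP/measurable_sv_atom.
- by move=> J x _; rewrite lee_fin mulr_ge0// indicE.
apply: eq_bigr => J _; under eq_integral do rewrite EFinM.
rewrite ge0_integralZl_EFin//.
- by rewrite integral_indic ?setIT//; exact: measurable_sv_atom.
- by apply/measurable_EFinP/measurable_indicP/measurable_sv_atom.
Qed.

Lemma measurable_sv_pattern s (f : {set 'I_(sv_size s)} -> R) :
  measurable_fun setT (fun x => f (sv_pattern s x)).
Proof.
under eq_fun do rewrite -sum_sv_atom.
apply: measurable_sum => J; apply: measurable_funM => //.
exact/measurable_indicP/measurable_sv_atom.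
Qed.

Lemma sv_funE s x : sv_fun s x = sv_atom_val (sv_pattern s x).
Proof.
rewrite /sv_fun /sv_atom_val [RHS]big_mkcond; apply: eq_bigr => i _.
by rewrite inE indicE; case: (_ \in _); rewrite ?scale1r ?scale0r.
Qed.

Lemma mu_sv_set s i :
  mu (sv_set (s := s) i) =
    (\sum_(J : {set 'I_(sv_size s)} | i \in J) mu (sv_atom J))%E.
Proof.
(* With this choice [f (sv_pattern s x)] is the indicator of [sv_set i] at [x]. *)
pose f (J : {set 'I_(sv_size s)}) : R := (i \in J)%:R.
have := @integral_sum_sv_atom s f (fun J => ler0n _ _).
under eq_integral do rewrite /f inE -indicE.
rewrite integral_indic ?setIT//; last exact: sv_measurable.
move=> ->; rewrite [RHS]big_mkcond/=; apply: eq_bigr => J _.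
by rewrite /f; case: (_ \in _); rewrite ?mul1e ?mul0e.
Qed.

(** Such an atom lies in [sv_set i]. The atom of the empty pattern, the complement of all the
    [sv_set], may have infinite measure; its value is an empty sum, so it contributes [0] to the
    integrals below. *)
Lemma mu_sv_atom_fin s i (J : {set 'I_(sv_size s)}) : i \in J ->
  mu (sv_atom J) \is a fin_num.
Proof.
move=> iJ; rewrite ge0_fin_numE// (le_lt_trans _ (sv_finite (s := s) i))//.
apply: le_measure; rewrite ?inE.
- exact: measurable_sv_atom.
- exact: sv_measurable.
- by move=> x xJ; rewrite -xJ inE in iJ; exact: set_mem.
Qed.

Lemma sv_integralE s :
  sv_integral s = \sum_J (fine (mu (sv_atom J)))%:C *: sv_atom_val (s := s) J.
Proof.
rewrite /sv_integral; under [RHS]eq_bigr do rewrite scaler_sumr big_mkcond.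
rewrite exchange_big/=; apply: eq_bigr => i _.
rewrite mu_sv_set -sum_fine; last exact: mu_sv_atom_fin.
rewrite rmorph_sum scaler_suml [LHS]big_mkcond; apply: eq_bigr => J _.
by case: ifP.
Qed.

(* Rewriting the simple function over its (disjoint) atoms reduces this to the
   triangle inequality. *)
Lemma rnorm_sv_integral s :
  ((rnorm (sv_integral s))%:E <= \int[mu]_x (rnorm (sv_fun s x))%:E)%E.
Proof.
under eq_integral do rewrite sv_funE.
rewrite (integral_sum_sv_atom (f := fun J => rnorm (sv_atom_val J)));
  last by move=> J; exact: rnorm_ge0.
rewrite sv_integralE (@le_trans _ _ (\sum_J
   (rnorm ((fine (mu (sv_atom J)))%:C *: sv_atom_val (s := s) J))%:E)%E)//.
  by rewrite sumEFin lee_fin rnorm_sum.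
apply: lee_sum => J _; rewrite rnormZ /= expr0n addr0 sqrtr_sqr EFinM muleC.
rewrite ger0_norm ?fine_ge0//.
have [JE|JE] := eqVneq J finset.set0.
  by rewrite /sv_atom_val JE big_set0 rnorm0 !mul0e.
by case/set0Pn: JE => i iJ; rewrite fineK// (mu_sv_atom_fin iJ).
Qed.

Lemma rnorm_sv_integral_le s (h : X -> \bar R) : measurable_fun setT h ->
  (forall x, (rnorm (sv_fun s x))%:E <= h x)%E ->
  ((rnorm (sv_integral s))%:E <= \int[mu]_x h x)%E.
Proof.
move=> mh sh; apply: (le_trans (rnorm_sv_integral s)).
apply: ge0_le_integral => //.
- by move=> x _; rewrite lee_fin rnorm_ge0.
- apply/measurable_EFinP; under eq_fun do rewrite sv_funE.
  exact: (measurable_sv_pattern (fun J => rnorm (sv_atom_val J))).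
Qed.

Definition sv_scale (c : R[i]) s : simple_vfun mu E :=
  SimpleVfun (fun i => c *: sv_val i) (sv_measurable (s := s))
    (sv_finite (s := s)).

Lemma sv_funZ c s x : sv_fun (sv_scale c s) x = c *: sv_fun s x.
Proof.
by rewrite /sv_fun scaler_sumr; apply: eq_bigr => i _; rewrite !scalerA mulrC.
Qed.

Lemma sv_integralZ c s : sv_integral (sv_scale c s) = c *: sv_integral s.
Proof.
rewrite /sv_integral scaler_sumr; apply: eq_bigr => i _.
by rewrite !scalerA mulrC.
Qed.

Definition sv_add_set s s' (i : 'I_(sv_size s + sv_size s')) : set X :=
  match fintype.split i with inl j => sv_set j | inr j => sv_set j end.

Definition sv_add_val s s' (i : 'I_(sv_size s + sv_size s')) : E :=
  match fintype.split i with inl j => sv_val j | inr j => sv_val j end.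

Lemma sv_add_measurable s s' i : measurable (@sv_add_set s s' i).
Proof.
by rewrite /sv_add_set; case: fintype.split => j; exact: sv_measurable.
Qed.

Lemma sv_add_finite s s' i : (mu (@sv_add_set s s' i) < +oo)%E.
Proof. by rewrite /sv_add_set; case: fintype.split => j; exact: sv_finite. Qed.

Definition sv_add s s' : simple_vfun mu E :=
  SimpleVfun (@sv_add_val s s') (@sv_add_measurable s s') (@sv_add_finite s s').

Let split_lshift m n i : fintype.split (lshift n i) = inl i :> 'I_m + 'I_n.
Proof. exact: (unsplitK (inl i)). Qed.

Let split_rshift m n i : fintype.split (rshift m i) = inr i :> 'I_m + 'I_n.
Proof. exact: (unsplitK (inr i)). Qed.

Lemma sv_funD s s' x : sv_fun (sv_add s s') x = sv_fun s x + sv_fun s' x.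
Proof.
rewrite /sv_fun big_split_ord/=; congr (_ + _); apply: eq_bigr => i _.
  by rewrite /sv_add_set /sv_add_val split_lshift.
by rewrite /sv_add_set /sv_add_val split_rshift.
Qed.

Lemma sv_integralD s s' :
  sv_integral (sv_add s s') = sv_integral s + sv_integral s'.
Proof.
rewrite /sv_integral big_split_ord/=; congr (_ + _); apply: eq_bigr => i _.
  by rewrite /sv_add_set /sv_add_val split_lshift.
by rewrite /sv_add_set /sv_add_val split_rshift.
Qed.

End simple_functions.

(** * Norm bound, uniqueness and homogeneity of the Bochner integral *)

Section bochner_facts.
Context {R : realType} {d : measure_display} {X : measurableType d}.
Variables (mu : {measure set X -> \bar R}) (E : normedModType R[i]).
Implicit Types (f : X -> E) (y : E).

Lemma is_bochner_integral_approx f y (e : R) :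
  is_bochner_integral mu f y -> 0 < e -> exists s : simple_vfun mu E,
    [/\ measurable_fun setT (fun x => rnorm (f x - sv_fun s x)),
        (\int[mu]_x (rnorm (f x - sv_fun s x))%:E < e%:E)%E &
        rnorm (y - sv_integral s) < e].
Proof.
move=> [s [ms s0 sy]] e0.
have intlt : \forall n \near \oo,
    (\int[mu]_x (rnorm (f x - sv_fun (s n) x))%:E < e%:E)%E.
  have /s0 : nbhs 0%E [set z : \bar R | (z < e%:E)%E]; last by [].
  apply: open_nbhs_nbhs; split; first exact: open_ereal_lt_ereal.
  by rewrite /= lte_fin.
have nlt : \forall n \near \oo, `|y - sv_integral (s n)| < e%:C.
  by move/cvgrPdist_lt : sy; apply; rewrite ltcR.
have [n [? ?]] := @filter_ex _ _ _ _ (filterI intlt nlt).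
by exists (s n); split => //; rewrite -rnorm_lt.
Qed.

(** An approximating simple function [s] is dominated pointwise by [h] plus the norm of [f - s]. The
    bound for simple functions then costs [e / 2] for the integral of that error and [e / 2] for the
    distance from [y] to the integral of [s]. *)
Lemma rnorm_bochner_integral_le f y (h : X -> \bar R) :
  is_bochner_integral mu f y -> measurable_fun setT h ->
  (forall x, (rnorm (f x))%:E <= h x)%E ->
  ((rnorm y)%:E <= \int[mu]_x h x)%E.
Proof.
move=> fy mh fh; apply/lee_addgt0Pr => e e0.
have h0 x : setT x -> (0 <= h x)%E.
  by move=> _; rewrite (le_trans _ (fh x))// lee_fin rnorm_ge0.
have [s [ms fs ys]] := is_bochner_integral_approx fy (divr_gt0 e0 (ltr0n R 2)).
have mfs : measurable_fun setT (fun x => (rnorm (f x - sv_fun s x))%:E).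
  exact/measurable_EFinP.
have sh : ((rnorm (sv_integral s))%:E <=
    \int[mu]_x h x + \int[mu]_x (rnorm (f x - sv_fun s x))%:E)%E.
  rewrite -ge0_integralD//; last by move=> x _; rewrite lee_fin rnorm_ge0.
  apply: rnorm_sv_integral_le => [|x]; first exact: emeasurable_funD.
  rewrite (le_trans _ (leeD (fh x) (lexx _)))// -EFinD lee_fin rnormB addrC.
  by rewrite (le_trans _ (rnormD _ _))// subrK.
rewrite (@le_trans _ _ ((rnorm (sv_integral s))%:E + (e / 2)%:E)%E)//.
  rewrite -EFinD lee_fin -[y](subrK (sv_integral s)) (le_trans (rnormD _ _))//.
  by rewrite addrC lerD2l ltW.
rewrite [e in leRHS]splitr EFinD addeA leeD2r// (le_trans sh)// leeD2l//.
exact: ltW.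
Qed.

(** The difference of two approximating simple functions is again simple, and its norm is at most
    the sum of the two approximation errors, so the two integrals are close. *)
Lemma is_bochner_integral_unique f y y' :
  is_bochner_integral mu f y -> is_bochner_integral mu f y' -> y = y'.
Proof.
move=> fy fy'; apply/eqP; rewrite -subr_eq0; apply/eqP/rnorm_eq0/le_anti.
rewrite rnorm_ge0 andbT; apply/ler_addgt0Pr => e e0; rewrite add0r.
(* Four errors add up: two in the integrals of [f - s] and [f - s'], two in the distances from [y]
   and [y'] to the simple integrals. *)
have e40 : 0 < e / 4 by rewrite divr_gt0.
have [s [ms fs ys]] := is_bochner_integral_approx fy e40.
have [s' [ms' fs' ys']] := is_bochner_integral_approx fy' e40.
have sE : rnorm (sv_integral s - sv_integral s') < e / 4 + e / 4.
  rewrite -scaleN1r -sv_integralZ -sv_integralD -lte_fin EFinD.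
  apply: le_lt_trans (lteD fs fs').
  rewrite -ge0_integralD//; try by move=> x _; rewrite lee_fin rnorm_ge0.
  - apply: rnorm_sv_integral_le => [|x].
      by apply: emeasurable_funD; exact/measurable_EFinP.
    rewrite -EFinD lee_fin sv_funD sv_funZ scaleN1r (rnormB (f x)).
    by rewrite (le_trans _ (rnormD _ _))// addrA subrK.
  - exact/measurable_EFinP.
  - exact/measurable_EFinP.
rewrite rnormB in ys'.
rewrite -(subrKA (sv_integral s)) -(subrKA (sv_integral s') _ (- y')).
apply: (le_trans (rnormD _ _)).
have := rnormD (sv_integral s - sv_integral s') (sv_integral s' - y').
lra.
Qed.

Lemma bochnerE f y : is_bochner_integral mu f y -> bochner mu f = y.
Proof.
by move=> fy; apply: (is_bochner_integral_unique (xgetPex 0 (ex_intro _ y fy))).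
Qed.

Lemma bochner0E f :
  ~ (exists y, is_bochner_integral mu f y) -> bochner mu f = 0.
Proof. by move=> nf; apply: xgetPN => y fy; apply: nf; exists y. Qed.

(** A non-integrable [f] has the default integral [0], and [h] is nonnegative, so the bound covers
    every [f]. *)
Lemma rnorm_bochner_le f (h : X -> \bar R) : measurable_fun setT h ->
  (forall x, (rnorm (f x))%:E <= h x)%E ->
  ((rnorm (bochner mu f))%:E <= \int[mu]_x h x)%E.
Proof.
move=> mh fh.
have [[y fy]|nf] := pselect (exists y, is_bochner_integral mu f y).
  by rewrite (bochnerE fy); exact: (rnorm_bochner_integral_le fy mh fh).
rewrite bochner0E// rnorm0 integral_ge0// => x _.
by rewrite (le_trans _ (fh x))// lee_fin rnorm_ge0.
Qed.

Lemma is_bochner_integralZ (c : R[i]) f y :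
  is_bochner_integral mu f y ->
  is_bochner_integral mu (fun x => c *: f x) (c *: y).
Proof.
move=> [s [ms s0 sy]].
have sE n x : rnorm (c *: f x - sv_fun (sv_scale c (s n)) x) =
    Normc.normc c * rnorm (f x - sv_fun (s n) x).
  by rewrite sv_funZ -scalerBr rnormZ.
exists (fun n => sv_scale c (s n)); split.
- by move=> n; under eq_fun do rewrite sE; exact: measurable_funM.
- under eq_fun do under eq_integral do rewrite sE EFinM.
  under eq_fun => n.
    rewrite ge0_integralZl_EFin ?normc_ge0//; first last.
    - exact/measurable_EFinP.
    - by move=> x _; rewrite lee_fin rnorm_ge0.
    over.
  by rewrite -(mule0 (Normc.normc c)%:E); exact: cvgeZl.
- by under eq_fun do rewrite sv_integralZ; apply: cvgZl_tmp.
Qed.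

(** As [c] is invertible, [f] and [c *: f] are integrable together, so the default value [0] occurs
    on both sides at once. *)
Lemma bochnerZ (c : R[i]) f : c != 0 ->
  bochner mu (fun x => c *: f x) = c *: bochner mu f.
Proof.
move=> c0; have [[y fy]|nf] := pselect (exists y, is_bochner_integral mu f y).
  by rewrite (bochnerE fy); apply/bochnerE/is_bochner_integralZ.
rewrite (bochner0E nf) scaler0 bochner0E// => -[y cfy]; apply: nf.
exists (c^-1 *: y); have := is_bochner_integralZ c^-1 cfy.
by under eq_fun do rewrite scalerA mulVf// scale1r.
Qed.

End bochner_facts.

(** * The dual group acting on compactly supported functions and on covariant representations *)

Section dual_action_on_Cc.
Context {R : realType} {G : topologicalZmodType} {A : banachAlgType R[i]}.
Variables (alpha : G -> A -> A) (nu : {measure set (borel G) -> \bar R}).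
Implicit Types (t s : dual_group R G) (a b c : Cc G A).

Lemma character_neq0 t g : t g != 0.
Proof. by rewrite -normr_eq0 character_norm oner_eq0. Qed.

Lemma character0 t : t 0 = 1.
Proof.
by apply: (mulfI (character_neq0 t 0)); rewrite -characterD addr0 mulr1.
Qed.

(** Writing the conjugate of [t] as the opposite character makes the group laws of the dual
    available. *)
Lemma cc_dualE t a g : cc_dual t a g = (- t) g *: a g.
Proof. by []. Qed.

Lemma cc_eqP a b : a =1 b -> a = b.
Proof. by move=> ab; apply/val_inj/funext. Qed.

Lemma cc_dual0 a : cc_dual 0 a = a.
Proof. by apply: cc_eqP => g; rewrite cc_dualE oppr0 scale1r. Qed.

Lemma cc_dualD t s a : cc_dual (t + s) a = cc_dual t (cc_dual s a).
Proof. by apply: cc_eqP => g; rewrite !cc_dualE opprD dual_addE scalerA. Qed.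

Lemma cc_dual_linear t : linear (cc_dual t : Cc G A -> Cc G A).
Proof.
move=> c a b; apply: cc_eqP => g; rewrite cc_dualE.
rewrite -[RHS]/(c *: cc_dual t a g + cc_dual t b g) !cc_dualE.
by rewrite scalerDr !scalerA mulrC.
Qed.

Definition is_cc_conv a b c := forall g, c g =
  bochner nu (fun h : borel G => a h ** alpha h (b (g - h))).

Lemma cc_convE a b c : is_cc_conv a b c -> cc_conv alpha nu a b = c.
Proof.
move=> abc; apply: xget_subset1 => // c1 c2 abc1 abc2.
by apply: cc_eqP => g; rewrite abc1 abc2.
Qed.

Lemma cc_conv0E a b :
  ~ (exists c, is_cc_conv a b c) -> cc_conv alpha nu a b = 0.
Proof. by move=> nab; apply: xgetPN => c abc; apply: nab; exists c. Qed.

(* If the convolution integral defines no element of [C_c], both sides are the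
   default value [0]. *)
Lemma cc_conv_dual t a b : (forall g, linear (alpha g)) ->
  cc_conv alpha nu (cc_dual t a) (cc_dual t b) =
  cc_dual t (cc_conv alpha nu a b).
Proof.
move=> lin_alpha.
(* Stated for an arbitrary character because it serves for [t] and for [- t]. *)
have convD r a' b' c : is_cc_conv a' b' c ->
    is_cc_conv (cc_dual r a') (cc_dual r b') (cc_dual r c).
  move=> abc g; rewrite cc_dualE abc -bochnerZ; last exact: character_neq0.
  congr (bochner _ _); apply/funext => h; rewrite !cc_dualE.
  rewrite (scalable_linear (lin_alpha h)) amulZl amulZr scalerA -characterD.
  by rewrite [h + _]addrC subrK.
have [[c abc]|nab] := pselect (exists c, is_cc_conv a b c).
  by rewrite (cc_convE abc) (cc_convE (convD t _ _ _ abc)).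
rewrite (cc_conv0E nab) cc_conv0E.
  by have := zmod_morphism_linear (cc_dual_linear t) 0 0; rewrite !subrr.
(* A convolution of the twisted functions, twisted back by [- t], would be a convolution of [a] and
   [b]. *)
move=> [c abc]; apply: nab; exists (cc_dual (- t) c).
by have := convD (- t) _ _ _ abc; rewrite -!cc_dualD !addNr !cc_dual0.
Qed.

Section twist.
Context {E : normedModType R[i]}.
Implicit Types (v : G -> bop E) (pi : A -> bop E).

Definition twist t v : G -> bop E := fun g => t g *: v g.

(** The scalars [t g] and [t (- g)] cancel in the conjugation of [pi a] by [v g]. *)
Lemma twist_covariant t v pi :
  covariant_rep alpha v pi -> covariant_rep alpha (twist t v) pi.
Proof.
move=> [v0 vD vc rpi cov]; split=> //.
- by rewrite /twist character0 scale1r.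
- by move=> g h; rewrite /twist vD characterD amulZl amulZr scalerA.
- move=> xi g; apply: (@cvgZ R[i] E); last exact: vc.
  exact: character_continuous.
- move=> g a; rewrite cov /twist !amulZl amulZr scalerA -characterD.
  by rewrite subrr character0 scale1r.
Qed.

Lemma twist_contractive t v pi :
  contractive_covariant v pi -> contractive_covariant (twist t v) pi.
Proof.
by move=> [v1 pi1]; split=> // g; rewrite normrZ character_norm mul1r.
Qed.

(** The scalar [(- t) g] passes from [a g] through [pi] onto [v g]. The integrands agree pointwise,
    hence so do the integrals, default value included. *)
Lemma integrated_form_dual t v pi a : linear pi ->
  integrated_form nu v pi (cc_dual t a) =
  integrated_form nu (twist (- t) v) pi a.
Proof.
move=> lpi; apply/funext => xi; congr (bochner _ _); apply/funext => g.
by rewrite cc_dualE (scalable_linear lpi) !bop_scaleE bopZ.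
Qed.

End twist.

(** * Invariance and continuity of the crossed product seminorm *)

Context {p : R} (p1 : 1 <= p).

Lemma crossed_seminorm_dual_le t a :
  (crossed_seminorm alpha nu p1 (cc_dual t a) <=
   crossed_seminorm alpha nu p1 a)%E.
Proof.
apply: ub_ereal_sup => _ [d [X [mu [v [pi [sf cov con nd ->]]]]]].
have lpi : linear pi by case: cov => _ _ _ [[]].
rewrite (integrated_form_dual t v a lpi).
apply: ereal_sup_ubound; exists d, X, mu, (twist (- t) v), pi.
split; [exact: sf|exact: twist_covariant|exact: twist_contractive|exact: nd|].
by [].
Qed.

(* Multiplying [v] by a character permutes the covariant representations. *)
Lemma crossed_seminorm_dual t a :
  crossed_seminorm alpha nu p1 (cc_dual t a) = crossed_seminorm alpha nu p1 a.
Proof.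
apply: le_anti; apply/andP; split; first exact: crossed_seminorm_dual_le.
have aE : a = cc_dual (- t) (cc_dual t a) by rewrite -cc_dualD addNr cc_dual0.
rewrite [in X in (X <= _)%E]aE; exact: crossed_seminorm_dual_le.
Qed.

Lemma closed_measurable (K : set G) :
  closed K -> measurable (K : set (borel G)).
Proof.
move=> cK; rewrite -[K]setCK; apply: measurableC; apply: sub_sigma_algebra.
exact: closed_openC.
Qed.

(** Since [v] and [pi] are contractive, the integrand at a vector of norm at most [1] is dominated
    by [M] times the indicator of [K], which is Borel because [K] is closed. *)
Lemma crossed_seminorm_le a (K : set G) (M : R) : closed K -> 0 <= M ->
  (forall g, K g -> rnorm (a g) <= M) -> (forall g, ~ K g -> a g = 0) ->
  (crossed_seminorm alpha nu p1 a <= M%:E * nu K)%E.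
Proof.
move=> cK M0 aM a0.
apply: ub_ereal_sup => _ [d [X [mu [v [pi [_ _ [v1 pi1] _ ->]]]]]].
apply: ub_ereal_sup => _ [xi /= xi1 <-].
have mK := closed_measurable cK.
rewrite (_ : (M%:E * nu K = \int[nu]_g (M * \1_(K : set (borel G)) g)%:E)%E).
  apply: rnorm_bochner_le => [|g].
    by apply/measurable_EFinP; apply: measurable_funM.
  have bound : rnorm (pi (a g) (v g xi)) <= rnorm (a g).
    rewrite (le_trans (rnorm_bop _ _))// -[leRHS]mulr1.
    rewrite ler_pM ?opnorm_ge0 ?rnorm_ge0//.
      by rewrite -rnorm_opE -lecR -!rnormE; exact: pi1.
    rewrite (le_trans (rnorm_bop _ _))// -[leRHS]mulr1.
    rewrite ler_pM ?opnorm_ge0 ?rnorm_ge0//.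
    by rewrite -rnorm_opE -lecR -rnormE; exact: v1.
  rewrite lee_fin (le_trans bound)// indicE.
  have [Kg|nKg] := pselect (K g); first by rewrite mem_set// mulr1 aM.
  by rewrite memNset// mulr0 a0// rnorm0.
under eq_integral do rewrite EFinM.
rewrite ge0_integralZl_EFin//.
- by rewrite integral_indic// setIT.
- exact/measurable_EFinP/measurable_indicP.
Qed.

Lemma rnorm_bounded_on_compact a (K : set G) : compact K ->
  exists2 M : R, 0 <= M & forall g, K g -> rnorm (a g) <= M.
Proof.
move=> cK; have /Cc_funP[ac _] := valP a.
have rc : {within K, continuous (fun g => rnorm (a g))}.
  apply: continuous_subspaceT => g; apply/cvgrPdist_lt => e e0.
  have /cvgrPdist_lt/(_ e%:C) := ac g; rewrite ltcR => /(_ e0).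
  apply: filterS => h; rewrite rnorm_lt; apply: le_lt_trans.
  rewrite ler_norml; apply/andP; split.
    by rewrite lerNl opprB lerBlDr rnormB (le_trans _ (rnormD _ _))// subrK.
  by rewrite lerBlDr (le_trans _ (rnormD _ _))// subrK.
(* Boundedness provides an upper bound by every real above [M], in particular [M + 1]; the absolute
   value makes it nonnegative. *)
have [M [_ /(_ (M + 1))]] := compact_bounded (continuous_compact rc cK).
rewrite ltrDl ltr01 => /(_ isT) KM; exists `|M + 1| => // g Kg.
have := KM (rnorm (a g)) (ex_intro2 _ _ g Kg erefl).
by move=> /(le_trans (ler_norm _))/le_trans; apply; exact: ler_norm.
Qed.

Hypothesis nu_compact : forall K : set G, compact K -> (nu K < +oo)%E.

Lemma crossed_seminorm_dual_continuous t a (e : R) : 0 < e ->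
  \forall s \near t,
    (crossed_seminorm alpha nu p1 (cc_dual t a - cc_dual s a)%R < e%:E)%E.
Proof.
move=> e0; have /Cc_funP[_ aK] := valP a.
set K := closure _ in aK.
have [M M0 aM] := rnorm_bounded_on_compact a aK.
have nuK : nu K \is a fin_num by rewrite ge0_fin_numE// nu_compact.
(* Adding [1] keeps [C] positive when [M] or [nu K] vanishes, and makes the final bound
   [e / C * M * nu K] strictly smaller than [e]. *)
pose C := M * fine (nu K) + 1.
have C0 : 0 < C by rewrite ltr_wpDl// mulr_ge0// fine_ge0.
have /dual_cvgP/(_ K aK (e / C)%:C) : nbhs t --> t by [].
rewrite ltcR divr_gt0// => /(_ isT); apply: filterS => s st.
apply: (@le_lt_trans _ _ ((e / C * M)%:E * nu K)%E).
  apply: crossed_seminorm_le.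
  - exact: closed_closure.
  - by rewrite mulr_ge0// divr_ge0// ltW.
  - move=> g Kg.
    rewrite -[X in rnorm X]/(cc_dual t a g - cc_dual s a g) -scalerBl rnormZ.
    rewrite ler_pM ?normc_ge0 ?rnorm_ge0 ?aM// ltW// -ltcR.
    by rewrite -[X in X < _]/(`|(t g)^* - (s g)^*|) -rmorphB conjc_norm st.
  - move=> g nKg; rewrite -[LHS]/(cc_dual t a g - cc_dual s a g) !cc_dualE.
    have [->|ag] := eqVneq (a g) 0; first by rewrite !scaler0 subr0.
    by case: nKg; exact: subset_closure.
rewrite -(fineK nuK) -EFinM lte_fin -mulrA -mulrA gtr_pMr//.
by rewrite -mulrA ltr_pdivrMl// mulr1 /C ltrDl.
Qed.

End dual_action_on_Cc.

(** * Continuity and density in complex normed spaces, with epsilons taken in [R] *)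

Lemma gt0_complexP {R : realType} (e : R[i]) :
  0 < e -> exists2 r : R, 0 < r & e = r%:C.
Proof.
case: e => a b; rewrite ltcE/= => /andP[/eqP -> a0]; by exists a.
Qed.

Lemma near_rnorm {R : realType} {E : normedModType R[i]} (x : E) (e : R) :
  0 < e -> \forall z \near x, rnorm (x - z) < e.
Proof.
move=> e0; have : nbhs x (ball x e%:C) by apply: nbhsx_ballx; rewrite ltcR.
by apply: filterS => z; rewrite -ball_normE/= rnorm_lt.
Qed.

Section dense_range.
Context {R : realType} {D : lmodType R[i]} {E F : normedModType R[i]}.

Lemma cvg_rnormP (T : topologicalType) (f : T -> F) x :
  f z @[z --> x] --> f x <->
  forall e : R, 0 < e -> \forall z \near x, rnorm (f x - f z) < e.
Proof.
split=> [/cvgrPdist_lt fx e e0|fx].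
  have := fx e%:C; rewrite ltcR => /(_ e0).
  by apply: filterS => z; rewrite rnorm_lt.
apply/cvgrPdist_lt => _ /gt0_complexP[e e0 ->].
by apply: filterS (fx e e0) => z; rewrite rnorm_lt.
Qed.

Lemma bounded_linear_cts (f : E -> F) (M : R) : linear f ->
  (forall x, rnorm (f x) <= M * rnorm x) -> continuous f.
Proof.
move=> lf fM x; apply/cvg_rnormP => e e0.
(* The constant [M] may be zero or negative; this replacement can be divided by. *)
have M0 : 0 < `|M| + 1 by rewrite ltr_wpDl.
apply: filterS (near_rnorm x (divr_gt0 e0 M0)) => z.
rewrite ltr_pdivlMr// mulrC; apply: le_lt_trans.
rewrite -(zmod_morphism_linear lf) (le_trans (fM _))// ler_wpM2r ?rnorm_ge0//.
by rewrite (le_trans (ler_norm _))// lerDl.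
Qed.

Variable i : D -> E.
Hypothesis i_dense : closure (range i) = setT.

Lemma dense_approx x (e : R) : 0 < e -> exists a, rnorm (x - i a) < e.
Proof.
move=> e0; have : closure (range i) x by rewrite i_dense.
by move=> /(_ _ (near_rnorm x e0))[_ [[a _ <-] ?]]; exists a.
Qed.

Lemma dense_eq (f g : E -> F) : continuous f -> continuous g ->
  (forall a, f (i a) = g (i a)) -> f = g.
Proof.
move=> fc gc fg; apply/funext => x; apply/eqP; rewrite -subr_eq0.
apply/eqP/rnorm_eq0/le_anti; rewrite rnorm_ge0 andbT.
apply/ler_addgt0Pr => e e0; rewrite add0r.
have e20 : 0 < e / 2 by rewrite divr_gt0.
have : closure (range i) x by rewrite i_dense.
move/cvg_rnormP: (fc x) => /(_ _ e20) fx.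
move/cvg_rnormP: (gc x) => /(_ _ e20) gx.
move=> /(_ _ (filterI fx gx))[_ [[a _ <-] [/= fa ga]]].
rewrite -(subrKA (f (i a))) (splitr e) (le_trans (rnormD _ _))//.
by rewrite lerD// ltW// fg rnormB.
Qed.

End dense_range.

(** * Extension of an isometry from a dense range by completeness *)

Section isometry_extension.
Context {R : realType} {D : lmodType R[i]} {E : normedModType R[i]}.
Context {F : completeNormedModType R[i]}.
Variables (i : D -> E) (T : D -> F).
Hypotheses (i_dense : closure (range i) = setT) (i_lin : linear i)
  (T_lin : linear T) (T_iso : forall a, rnorm (T a) = rnorm (i a)).

(* The closure of the graph of [i a |-> T a]. *)
Let graph (x : E) (y : F) := forall e : R, 0 < e ->
  exists a, rnorm (x - i a) < e /\ rnorm (y - T a) < e.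

Let graph_norm x y : graph x y -> rnorm y = rnorm x.
Proof.
move=> xy; apply/le_anti/andP; split; apply/ler_addgt0Pr => e e0;
  have [a [xa ya]] := xy _ (divr_gt0 e0 (ltr0n R 2)).
  rewrite -[y](subrK (T a)) (le_trans (rnormD _ _))// T_iso.
  rewrite rnormB in xa.
  have := rnormD (i a - x) x; rewrite subrK; lra.
rewrite -[x](subrK (i a)) (le_trans (rnormD _ _))// -T_iso.
rewrite rnormB in ya.
have := rnormD (T a - y) y; rewrite subrK; lra.
Qed.

Let graph_lin (c : R[i]) x y x' y' :
  graph x y -> graph x' y' -> graph (c *: x + x') (c *: y + y').
Proof.
(* A positive bound of the modulus of [c]: an error [e / 2 / M], once scaled by [c], stays within
   [e / 2]. *)
move=> xy xy' e e0; pose M := Normc.normc c + 1.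
have M0 : 0 < M by rewrite ltr_wpDl// normc_ge0.
have [a [xa ya]] := xy (e / 2 / M) (divr_gt0 (divr_gt0 e0 (ltr0n R 2)) M0).
have [b [xb yb]] := xy' (e / 2) (divr_gt0 e0 (ltr0n R 2)).
have bound (V : normedModType R[i]) (u v u' v' : V) :
    rnorm (u - v) < e / 2 / M -> rnorm (u' - v') < e / 2 ->
    rnorm (c *: u + u' - (c *: v + v')) < e.
  move=> uv uv'; rewrite opprD addrACA -scalerBr (le_lt_trans (rnormD _ _))//.
  rewrite (splitr e) ler_ltD// rnormZ.
  have -> : e / 2 = M * (e / 2 / M) by rewrite [RHS]mulrC divfK// gt_eqF.
  by rewrite ler_pM ?normc_ge0 ?rnorm_ge0 ?(ltW uv)// lerDl.
by exists (c *: a + b); rewrite i_lin T_lin; split; exact: bound.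
Qed.

(** By linearity of the graph the difference of two values over [x] lies over [0], and the graph
    preserves norms. *)
Let graph_fun x y y' : graph x y -> graph x y' -> y = y'.
Proof.
move=> xy xy'; have /graph_norm := graph_lin (-1) xy xy'.
rewrite !scaleN1r addNr rnorm0 => /rnorm_eq0 yy'; apply/esym/eqP.
by rewrite -subr_eq0 addrC yy'.
Qed.

(** The images [T a] of the approximants [i a] of [x] form a Cauchy filter, because [T] has the same
    norms as [i]; its limit in the complete space [F] is the required value. *)
Let graph_total x : exists y, graph x y.
Proof.
pose B (e : R) := [set T a | a in [set a | rnorm (x - i a) < e]].
pose Fx := filter_from [set e : R | 0 < e] B.
have FFx : ProperFilter Fx.
  apply: filter_from_proper; last first.
    by move=> e /= /(dense_approx i_dense x)[a xa]; exists (T a), a.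
  apply: filter_from_filter; first by exists 1 => /=.
  move=> e e' e0 e0'; exists (Num.min e e'); first by rewrite /= lt_min e0.
  move=> _ [a /= xa <-]; move: xa; rewrite lt_min => /andP[xe xe'].
  by split; exists a.
have Fx_cauchy : cauchy Fx.
  apply: cauchy_exP => _ /gt0_complexP[e e0 ->].
  have e20 : 0 < e / 2 by rewrite divr_gt0.
  have [a xa] := dense_approx i_dense x e20.
  exists (T a), (e / 2) => // _ [b /= xb <-].
  rewrite -ball_normE/= rnorm_lt -(zmod_morphism_linear T_lin) T_iso.
  rewrite (zmod_morphism_linear i_lin) -(subrKA x).
  by rewrite (le_lt_trans (rnormD _ _))// (splitr e) ltrD// rnormB.
have /cvg_ex[y Fxy] : cvg Fx by exact: cauchy_cvg.
exists y => e e0; have [|e' e0' yB] := Fxy (ball y e%:C).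
  by apply: nbhsx_ballx; rewrite ltcR.
(* A single [a] must have [i a] within [e] of [x] and, through [e'], have [T a] within [e] of the
   limit. *)
have ee0 : 0 < Num.min e e' by rewrite lt_min e0.
have [a] := dense_approx i_dense x ee0.
rewrite lt_min => /andP[xa xa']; exists a; split=> //.
by have := yB (T a) (ex_intro2 _ _ a xa' erefl); rewrite -ball_normE/= rnorm_lt.
Qed.

(** [i] may have a kernel, which [T] shares by [T_iso]; passing through the graph avoids choosing
    preimages under [i]. *)
Lemma isometry_extension : exists S : E -> F,
  [/\ linear S, forall x, rnorm (S x) = rnorm x & forall a, S (i a) = T a].
Proof.
have [S gS] := choice graph_total; exists S; split.
- by move=> c x y; apply: (graph_fun (gS _)); exact: graph_lin.
- by move=> x; exact: graph_norm.
- move=> a; apply: (graph_fun (gS _)) => e e0; exists a.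
  by rewrite !subrr !rnorm0.
Qed.

End isometry_extension.

(** * Extension of the dual action to the full crossed product *)

Section dual_action.
Context {R : realType} {p : R} (p1 : 1 <= p) {G : topologicalZmodType}.
Context {nu : {measure set (borel G) -> \bar R}} {A : banachAlgType R[i]}.
Context {alpha : G -> A -> A} {F : banachAlgType R[i]} {iota : Cc G A -> F}.
Hypothesis F_crossed : full_crossed_product alpha nu p1 iota.

Let iota_linear : linear iota. Proof. by case: F_crossed. Qed.

Let iota_dense : closure (range iota) = setT. Proof. by case: F_crossed. Qed.

Lemma rnorm_iota_dual (t : dual_group R G) (a : Cc G A) :
  rnorm (iota (cc_dual t a)) = rnorm (iota a).
Proof.
have [_ _ _ iotaE] := F_crossed.
have := crossed_seminorm_dual alpha nu p1 t a; rewrite -!iotaE.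
by case.
Qed.

Lemma dual_extension (t : dual_group R G) : exists S : F -> F,
  [/\ linear S, forall x, rnorm (S x) = rnorm x &
      forall a, S (iota a) = iota (cc_dual t a)].
Proof.
apply: (isometry_extension (T := fun a => iota (cc_dual t a)) iota_dense).
- exact: iota_linear.
- by move=> c a b; rewrite cc_dual_linear iota_linear.
- exact: rnorm_iota_dual.
Qed.

Lemma isometry_cts (S : F -> F) :
  linear S -> (forall x, rnorm (S x) = rnorm x) -> continuous S.
Proof.
move=> lS iS; apply: (@bounded_linear_cts _ _ _ S 1) => // x.
by rewrite mul1r iS.
Qed.

Lemma amul_cts_r (x : F) : continuous (amul x).
Proof.
apply: (@bounded_linear_cts _ _ _ _ (rnorm x)).
  by move=> c y z; rewrite amulDr amulZr.
by move=> y; rewrite -lecR rmorphM/= -!rnormE ler_normAM.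
Qed.

Lemma amul_cts_l (x : F) : continuous (amul^~ x).
Proof.
apply: (@bounded_linear_cts _ _ _ _ (rnorm x)).
  by move=> c y z; rewrite amulDl amulZl.
by move=> y; rewrite -lecR rmorphM/= -!rnormE mulrC ler_normAM.
Qed.

Lemma dual_extension_mul (t : dual_group R G) (S : F -> F) :
  (forall g, linear (alpha g)) -> continuous S ->
  (forall a, S (iota a) = iota (cc_dual t a)) ->
  {morph S : x y / x ** y}.
Proof.
move=> lin_alpha Sc SE; have [_ iotaM _ _] := F_crossed.
(* Density is used one factor at a time: first in the right factor, with the left one in the range
   of [iota], then in the left factor. *)
have S_iota a : S \o amul (iota a) = amul (S (iota a)) \o S.
  apply: (dense_eq iota_dense) => [x|x|b] /=.
  - by apply: continuous_comp; [exact: amul_cts_r|exact: Sc].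
  - by apply: continuous_comp; [exact: Sc|exact: amul_cts_r].
  - by rewrite -iotaM !SE -iotaM cc_conv_dual.
move=> x y; suff /(congr1 (fun f => f x)) : S \o amul^~ y = amul^~ (S y) \o S.
  by [].
apply: (dense_eq iota_dense) => [z|z|a] /=.
- by apply: continuous_comp; [exact: amul_cts_l|exact: Sc].
- by apply: continuous_comp; [exact: Sc|exact: amul_cts_l].
- by have := congr1 (fun f : F -> F => f y) (S_iota a).
Qed.

End dual_action.

Theorem theorem3p18 (R : realType) (p : R) (p1 : 1 <= p)
    (G : topologicalZmodType) (G_lca : second_countable_lca G)
    (nu : {measure set (borel G) -> \bar R}) (nu_haar : haar_measure nu)
    (A : banachAlgType R[i]) (A_Lp : Lp_operator_algebra p1 A)
    (alpha : G -> A -> A) (alpha_act : continuous_action alpha)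
    (alpha_iso : isometric_action alpha)
    (A_rep : nondeg_sigma_finitely_representable p1 A)
    (F : banachAlgType R[i]) (iota : Cc G A -> F)
    (F_crossed : full_crossed_product alpha nu p1 iota) :
  exists! alpha_hat : dual_group R G -> F -> F,
    [/\ continuous_action alpha_hat,
        isometric_action alpha_hat &
        forall (t : dual_group R G) (a : Cc G A),
          alpha_hat t (iota a) = iota (cc_dual t a)].
Proof.
have [H S_] := choice (dual_extension F_crossed).
have [iota_lin _ iota_dense iotaE] := F_crossed.
have [H_lin H_iso HE] : [/\ forall t, linear (H t),
    forall t x, rnorm (H t x) = rnorm x &
    forall t a, H t (iota a) = iota (cc_dual t a)].
  by split=> t; have [] := S_ t.
have H_cts t : continuous (H t) by exact: isometry_cts.
have H0 x : H 0 x = x.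
  suff -> : H 0 = id by [].
  apply: (dense_eq iota_dense) => [||a]; first exact: H_cts.
    by move=> y; exact: cvg_id.
  by rewrite HE cc_dual0.
have HD t s x : H (t + s) x = H t (H s x).
  suff -> : H (t + s) = H t \o H s by [].
  apply: (dense_eq iota_dense) => [|y|a]; first exact: H_cts.
    by apply: continuous_comp; exact: H_cts.
  by rewrite /= !HE cc_dualD.
have lin_alpha g : linear (alpha g).
  by have [/(_ g)[[]]] := alpha_act.
exists H; split.
  split=> //; last by move=> t x; rewrite !rnormE H_iso.
  split=> // [t|x t].
    split; last exact: H_cts.
      split; first exact: H_lin.
      exact: (dual_extension_mul F_crossed lin_alpha (H_cts t) (HE t)).
    (* The inverse of [H t] comes from the opposite character. *)
    by exists (H (- t)) => x; rewrite -HD ?addNr ?subrr H0.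
  (* Strong continuity at [x]: as every [H r] is isometric, replacing [x] by a nearby [iota a] costs
     [e / 3] at [t] and at [s] alike; the last third is the continuity of the seminorm at [a]. *)
  apply/cvg_rnormP => e e0; have e30 : 0 < e / 3 by rewrite divr_gt0.
  have [a xa] := dense_approx iota_dense x e30.
  have nu_compact := haar_compact nu_haar.
  apply: filterS (crossed_seminorm_dual_continuous alpha p1 nu_compact t a e30).
  move=> s; rewrite -iotaE lte_fin => ts.
  rewrite (zmod_morphism_linear iota_lin) -!HE in ts.
  have Hx r : rnorm (H r x - H r (iota a)) < e / 3.
    by rewrite -(zmod_morphism_linear (H_lin r)) H_iso.
  have tx := Hx t; have sx := Hx s; rewrite rnormB in sx.
  rewrite -(subrKA (H t (iota a))) -(subrKA (H s (iota a)) _ (- H s x)).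
  apply: (le_lt_trans (rnormD _ _)).
  have := rnormD (H t (iota a) - H s (iota a)) (H s (iota a) - H s x).
  lra.
(* Uniqueness: equivariance fixes each continuous map [H' t] on the dense range of [iota]. *)
move=> H' [[H'_hom _ _ _] _ H'E]; apply/funext => t.
apply: (dense_eq iota_dense) => [||a]; [exact: H_cts| |by rewrite HE H'E].
by have [] := H'_hom t.
Qed.
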